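(* Let $t > 0$, $h > 0$, $\rho \in (0,1)$ and $x \in \mathbb{R}$. Let $B^1 = (B^1_s)_{s\ge 0}$ be a standard Brownian motion, let $\tau^h = \inf\{s \geq 0 : B^1_s = h\}$, and let $\tilde{B}^h$ be the reflection of $B^1$ at the level $h$, defined by $\tilde{B}^h_s = -B^1_s + 2\,(B^1_s - B^1_{\tau^h})\,\mathbf{1}_{s \geq \tau^h}$ for $s \ge 0$. Let $Z$ be a standard Brownian motion independent of $B^1$ and let $B^2 = \rho \tilde{B}^h + \sqrt{1-\rho^2}\, Z$. Then $$\mathbb{P}\left(B^1_t - B^2_t \geq x\right) = \Phi\left(\frac{-x+2\rho h}{\sqrt{2(1-\rho)t}}\right)\Phi\left(\frac{x-2h(1+\rho)}{\sqrt{2(1+\rho)t}}\right) + \Phi\left(\frac{2h-x}{\sqrt{2(1-\rho)t}}\right)\Phi\left(\frac{-x}{\sqrt{2(1+\rho)t}}\right).$$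
   Context: $\Phi$ denotes the cumulative distribution function of a standard normal random variable. Brownian motions start at $0$ and are defined on a filtered probability space $(\Omega,\mathcal{F},(\mathcal{F}_t)_{t\ge0},\mathbb{P})$ satisfying the usual hypotheses (right continuity and completeness). *)

(* Defs.v *)
From HB Require Import structures.
From mathcomp Require Import all_boot all_order all_algebra.
From mathcomp Require Import all_classical all_reals all_analysis.

Set Implicit Arguments.
Unset Strict Implicit.
Unset Printing Implicit Defensive.

Import Order.TTheory GRing.Theory Num.Theory.
Import numFieldNormedType.Exports.

Local Open Scope classical_set_scope.
Local Open Scope ring_scope.

(* Continuous-time processes and filtrations are indexed by all of [R], but
   only their values at nonnegative times are ever constrained or used. *)

Definition Phi {R : realType} (x : R) : R :=
  fine (normal_prob 0 1 `]-oo, x]).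

Section Processes.
Context {d : measure_display} {T : measurableType d} {R : realType}.
Variable P : probability T R.

Record usual_filtration (F : R -> set_system T) : Prop := UsualFiltration {
  filtration_sigma : forall s : R, 0 <= s -> sigma_algebra setT (F s);
  filtration_sub : forall s : R, 0 <= s -> F s `<=` measurable;
  filtration_mono : forall s u : R, 0 <= s -> s <= u -> F s `<=` F u;
  filtration_right_continuous :
    forall s : R, 0 <= s -> F s = \bigcap_(u in `]s, +oo[) F u;
  (* [P.-negligible] sets are all subsets of measurable null sets, so this
     also makes the underlying probability space complete *)
  filtration_complete : P.-negligible `<=` F 0 }.

Definition sigma_rv (X : T -> R) : set_system T :=
  preimage_set_system setT X measurable.

Definition sigma_process (X : R -> T -> R) : set_system T :=
  <<s \bigcup_(s in (`[0, +oo[ : set R)) sigma_rv (X s) >>.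

Definition independent_systems (G H : set_system T) : Prop :=
  forall A B, G A -> H B -> P (A `&` B) = (P A * P B)%E.

Definition independent_processes (X Y : R -> T -> R) : Prop :=
  independent_systems (sigma_process X) (sigma_process Y).

Record brownian_motion (F : R -> set_system T) (B : R -> T -> R) : Prop :=
  BrownianMotion {
  bm_adapted : forall s : R, 0 <= s -> sigma_rv (B s) `<=` F s;
  bm_start : {ae P, forall w, B 0 w = 0};
  bm_continuous :
    {ae P, forall w,
      {within (`[0, +oo[ : set R), continuous (fun s : R => B s w)}};
  bm_independent_increments : forall s u : R, 0 <= s -> s < u ->
    independent_systems (F s) (sigma_rv (B u \- B s));
  (* the second parameter of [normal_prob] is the standard deviation *)
  bm_normal_increments : forall s u : R, 0 <= s -> s < u ->
    forall U : set R, measurable U ->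
      P ((B u \- B s) @^-1` U) = normal_prob 0 (Num.sqrt (u - s)) U }.

End Processes.

Section Reflection.
Context {T : Type} {R : realType}.

(* [+oo] when the level is never reached *)
Definition hitting_time (X : R -> T -> R) (h : R) (w : T) : \bar R :=
  ereal_inf [set s%:E | s in [set s : R | 0 <= s /\ X s w = h]].

(* when the hitting time is [+oo] the indicator vanishes, so the value
   [fine +oo = 0] is irrelevant *)
Definition reflection (X : R -> T -> R) (h : R) (s : R) (w : T) : R :=
  - X s w + 2 * (X s w - X (fine (hitting_time X h w)) w)
              * \1_[set u : R | (hitting_time X h w <= u%:E)%E] s.

End Reflection.

(* Main.v *)
Require Import Defs.
From HB Require Import structures.
From mathcomp Require Import all_boot all_order all_algebra.
From mathcomp Require Import all_classical all_reals all_analysis.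
From mathcomp Require Import measurable_realfun ring lra.

Set Implicit Arguments.
Unset Strict Implicit.
Unset Printing Implicit Defensive.

Import Order.TTheory GRing.Theory Num.Theory.
Import numFieldNormedType.Exports.

Local Open Scope classical_set_scope.
Local Open Scope ring_scope.

(* Write X = B1, c = sqrt (1 - rho^2), and let D be the event tau <= t.  On D
   the event {B1_t - B2_t >= x} is the half-plane (1 - rho) X_t - c Z_t >=
   x - 2 rho h, off D it is (1 + rho) X_t - c Z_t >= x.  By the reflection
   principle, on D the pair (X_t, Z_t) has the same law as (2 h - X_t, Z_t), and
   {X_t >= h} is contained in D, so D can be eliminated and only probabilities of
   half-planes cut by the line X_t = h remain.  They recombine into two
   quadrants for U = (1 + rho) X_t -/+ c Z_t and V = (1 - rho) X_t +/- c Z_t, with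
   corners on the line U + V = 2 X_t = 2 h.  Up to scaling (U, V) is a rotation of
   (X_t, Z_t), so U and V are independent centred Gaussians with variances
   2 (1 + rho) t and 2 (1 - rho) t.

   The reflection principle is obtained without stopping times: for the first
   dyadic time s at which X is within e of h, the increment X_t - X_s is symmetric
   and independent of the past, which gives, for every b,
   P (hit, X_t <= b) <= P (hit, X_t >= 2 h - b - 2 e); then e tends to 0. *)

(** * Rotation invariance of planar Gaussian measures *)

(* The measure structure of [pushforward m f] is indexed by the proof that [f] is
   measurable, which unification cannot recover. *)
Definition pushforward_measure d d' (T1 : measurableType d)
    (T2 : measurableType d') (R : realFieldType)
    (m : {measure set T1 -> \bar R}) (f : T1 -> T2)
    (mf : measurable_fun setT f) : {measure set T2 -> \bar R} :=
  measure_function_pushforward__canonical__measure_function_Measure m mf.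

(** The pushforward of Lebesgue measure under [x -> a * x + b], multiplied by [a], gives every
    half-open interval its length, so it is Lebesgue measure by uniqueness. *)
Lemma ge0_integral_affine (R : realType) (a b : R) (f : R -> \bar R) :
  0 < a -> measurable_fun [set: R] f -> (forall x, (0 <= f x)%E) ->
  (\int[lebesgue_measure]_x f x =
   a%:E * \int[lebesgue_measure]_x f (a * x + b)%R)%E.
Proof.
move=> a0 mf f0.
pose F : R -> measurableTypeR R := fun x => a * x + b.
have mF : measurable_fun [set: R] F.
  by apply: measurable_funD => //; apply: measurable_funM.
pose a' : {nonneg R} := NngNum (ltW a0).
pose m := mscale a' (pushforward_measure (@lebesgue_measure R) mF).
have mE A : measurable A -> lebesgue_measure A = m A.
  apply: lebesgue_measure_unique => _ [[u v] _ <-] /=.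
  rewrite /m /mscale/= /pushforward.
  have -> : F @^-1` `]u, v] = `](u - b) / a, (v - b) / a]%classic.
    apply/seteqP; split => x /=; rewrite !in_itv/= /F
      ltr_pdivrMr// ler_pdivlMr// ![x * a]mulrC; lra.
  rewrite !lebesgue_measure_itv/= !lte_fin ltr_pM2r ?invr_gt0// ltrD2r.
  case: ifPn => _; rewrite ?mule0// -!EFinD -EFinM; congr EFin.
  by field; rewrite gt_eqF.
have -> : (\int[lebesgue_measure]_x f x = \int[m]_x f x)%E.
  by apply: eq_measure_integral => A mA _; exact: mE.
rewrite ge0_integral_mscale//; congr (_ * _)%E.
by rewrite ge0_integral_pushforward// => x _.
Qed.

Section Rotation.
Context {R : realType}.
Local Notation mu := (@lebesgue_measure R).
Implicit Type g : R * R -> \bar R.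

(** With the first coordinate fixed, the shear translates the second one; by Tonelli it acts on the
    inner integral alone. *)
Lemma ge0_integral_shear g (a : R) :
  measurable_fun setT g -> (forall z, (0 <= g z)%E) ->
  (\int[mu \x mu]_z g (z.1, (z.2 + a * z.1)%R) = \int[mu \x mu]_z g z)%E.
Proof.
move=> mg g0.
have msh : measurable_fun [set: R * R] (fun z : R * R => g (z.1, z.2 + a * z.1)).
  apply: (measurableT_comp mg); apply: measurable_fun_pair => //.
  by apply: measurable_funD => //; apply: measurable_funM.
rewrite !fubini_tonelli1//; apply: eq_integral => x _.
rewrite [RHS]/fubini_F [RHS](ge0_integral_affine (a * x) ltr01)//; last first.
  by apply: (measurableT_comp mg); exact: measurable_fun_pair.
by rewrite mul1e; apply: eq_integral => y _; rewrite mul1r.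
Qed.

Lemma ge0_integral_swap g :
  measurable_fun setT g -> (forall z, (0 <= g z)%E) ->
  (\int[mu \x mu]_z g (z.2, z.1) = \int[mu \x mu]_z g z)%E.
Proof.
move=> mg g0; have mg' : measurable_fun [set: R * R] (fun z => g (z.2, z.1)).
  by apply: (measurableT_comp mg); exact: measurable_fun_pair.
by rewrite fubini_tonelli1// fubini_tonelli2.
Qed.

(* A rotation of angle [a] is a product of three shears, the outer two of
   parameter [p = - tan (a / 2) = (c - 1) / s]. *)
Lemma ge0_integral_rotation g (c s : R) : c ^+ 2 + s ^+ 2 = 1 -> s != 0 ->
  measurable_fun setT g -> (forall z, (0 <= g z)%E) ->
  (\int[mu \x mu]_z g ((c * z.1 - s * z.2)%R, (s * z.1 + c * z.2)%R) =
   \int[mu \x mu]_z g z)%E.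
Proof.
move=> cs s0 mg g0.
pose p := (c - 1) / s.
pose shy a (z : R * R) := (z.1, z.2 + a * z.1).
pose shx a (z : R * R) := (z.1 + a * z.2, z.2).
have mshy a : measurable_fun setT (shy a).
  apply: measurable_fun_pair => //.
  by apply: measurable_funD => //; apply: measurable_funM.
have mshx a : measurable_fun setT (shx a).
  apply: measurable_fun_pair => //.
  by apply: measurable_funD => //; apply: measurable_funM.
(* A horizontal shear is a vertical one conjugated by the swap of coordinates. *)
have integral_shx a f : measurable_fun [set: R * R] f -> (forall z, (0 <= f z)%E) ->
    (\int[mu \x mu]_z f (shx a z) = \int[mu \x mu]_z f z)%E.
  move=> mf f0; rewrite -(ge0_integral_swap mf f0).
  have msw : measurable_fun [set: R * R] (fun z : R * R => f (z.2, z.1)).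
    by apply: (measurableT_comp mf); exact: measurable_fun_pair.
  rewrite -(ge0_integral_shear a msw)//.
  have mf' := measurableT_comp mf (mshx a).
  exact/esym/(ge0_integral_swap mf')/(fun z => f0 _).
transitivity (\int[mu \x mu]_z (g \o shx p \o shy s) (shx p z))%E.
  (* The first identity is the definition of [p], the second follows from s^2 = 1 - c^2; they turn
     the coefficients of the triple shear into those of the rotation. *)
  have ps : p * s = c - 1 by rewrite /p divfK.
  have pc : p * (c + 1) = - s.
    apply: (mulIf s0); rewrite mulrAC ps mulNr.
    by have -> : s * s = 1 - c ^+ 2; [rewrite -cs; ring|ring].
  clearbody p.
  apply: eq_integral => z _ /=; congr (g (_, _)); rewrite /shy /shx /=; first last.
    rewrite -[c](subrK 1) -ps /shy /shx /=; ring.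
  have -> : z.1 + p * z.2 + p * (z.2 + s * (z.1 + p * z.2)) =
    (1 + p * s) * z.1 + p * (p * s + 1 + 1) * z.2 by ring.
  by rewrite ps subrK pc mulNr [1 + _]addrC subrK.
have mg1 := measurableT_comp mg (mshx p).
have mg2 := measurableT_comp mg1 (mshy s).
rewrite (integral_shx p _ mg2 (fun=> g0 _)).
rewrite (ge0_integral_shear s mg1 (fun=> g0 _)).
exact: (integral_shx p g mg g0).
Qed.

End Rotation.

Section NormalProb.
Context {R : realType}.
Local Notation mu := (@lebesgue_measure R).

Lemma normal_prob_scale (s : R) (A : set R) : 0 < s -> measurable A ->
  normal_prob 0 s A = normal_prob 0 1 [set y | A (s * y)].
Proof.
move=> s0 mA.
rewrite /normal_prob integral_mkcond [RHS]integral_mkcond.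
set f := (X in (\int[_]_x X x = _)%E).
have mf : measurable_fun [set: R] f.
  apply/(measurable_restrictT _ _).1 => //.
  by apply: measurable_funTS; apply/measurable_EFinP; exact: measurable_normal_pdf.
have f0 x : (0 <= f x)%E.
  by rewrite /f patchE; case: ifP => // _; rewrite lee_fin normal_pdf_ge0.
rewrite (ge0_integral_affine 0 s0 mf f0).
have mf' : measurable_fun [set: measurableTypeR R] (fun x => f (s * x + 0)).
  by apply: (measurableT_comp mf); apply: measurable_funD.
rewrite -(ge0_integralZl _ measurableT mf' (fun x _ => f0 _)) ?lee_fin ?ltW//.
rewrite /f {f mf f0 mf'}.
apply: eq_integral => x _; rewrite !patchE addr0.
have -> : (s * x \in A) = (x \in [set y | A (s * y)]).
  by apply/idP/idP; rewrite !inE.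
case: ifP => _; last by rewrite mule0.
rewrite -EFinM; congr EFin; rewrite !normal_pdfE ?gt_eqF//.
rewrite /normal_peak /normal_fun !subr0 expr1n mul1r mulrA -mulrnAr.
rewrite sqrtrM ?sqr_ge0// sqrtr_sqr gtr0_norm// invfM mulrA divff ?gt_eqF//.
by rewrite mul1r; congr (_ * expR _); field; rewrite gt_eqF.
Qed.

Lemma normal_probN (s : R) (A : set R) : s != 0 -> measurable A ->
  normal_prob 0 s [set y | A (- y)] = normal_prob 0 s A.
Proof.
move=> s0 mA; rewrite /normal_prob.
have mN : measurable_fun [set: measurableTypeR R]
    (-%R : measurableTypeR R -> measurableTypeR R) by exact: oppr_measurable.
have -> : (\int[mu]_(x in A) (normal_pdf 0 s x)%:E =
  \int[pushforward_measure mu mN]_(x in A) (normal_pdf 0 s x)%:E)%E.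
  by apply: eq_measure_integral => B mB _; exact/esym/lebesgue_measureN.
rewrite ge0_integral_pushforward//.
- by apply: eq_integral => x _ /=; rewrite !normal_pdfE// /normal_fun !subr0 sqrrN.
- by apply: measurable_funTS; apply/measurable_EFinP; exact: measurable_normal_pdf.
- by move=> x _; rewrite lee_fin normal_pdf_ge0.
Qed.

Section NormalRotation.
Variable s0 : R.
Hypothesis s0_neq0 : s0 != 0.
Local Notation gamma := (@normal_prob R 0 s0).

Let dens (z : R * R) : \bar R := (normal_pdf 0 s0 z.1 * normal_pdf 0 s0 z.2)%:E.

Let dens_ge0 z : (0 <= dens z)%E.
Proof. by rewrite lee_fin mulr_ge0// normal_pdf_ge0. Qed.

Let mdens : measurable_fun setT dens.
Proof.
apply/measurable_EFinP; apply: measurable_funM;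
  by apply: (measurableT_comp (measurable_normal_pdf _ _)).
Qed.

Local Notation mR := (measurableTypeR R).

(** The product of the two normal laws, written with a planar density so that the rotation
    invariance of Lebesgue measure applies. *)
Let nu (A : set (mR * mR)) := (\int[mu \x mu]_(z in A) dens z)%E.

Let nu0 : nu set0 = 0%E. Proof. exact: integral_set0. Qed.

Let nu_ge0 A : (0 <= nu A)%E.
Proof. exact: integral_ge0. Qed.

Let nu_sigma_additive : semi_sigma_additive nu.
Proof.
move=> F mF tF mUF; rewrite /nu ge0_integral_bigcup//.
  by apply: is_cvg_nneseries => n _ _; exact: nu_ge0.
exact: measurable_funTS.
Qed.

HB.instance Definition _ := isMeasure.Build _ _ _
  nu nu0 nu_ge0 nu_sigma_additive.

Let mpatch (B : set mR) : measurable B ->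
  measurable_fun [set: mR] (EFin \o normal_pdf 0 s0 \_ B).
Proof.
move=> mB; apply/measurable_EFinP/(measurable_restrictT _ _).1 => //.
by apply: measurable_funTS; exact: measurable_normal_pdf.
Qed.

Let patch_ge0 (B : set mR) x : (0 <= (normal_pdf 0 s0 \_ B) x)%R.
Proof. by rewrite patchE; case: ifP => // _; rewrite normal_pdf_ge0. Qed.

(** The product measure is determined by rectangles, on which Tonelli factors the integral of the
    product density. *)
Let nuE (A : set (mR * mR)) : measurable A -> (gamma \x gamma)%E A = nu A.
Proof.
apply: product_measure_unique => B C mB mC /=.
pose p D (x : mR) := ((normal_pdf 0 s0 \_ D) x)%:E.
have gammaE D : gamma D = (\int[mu]_x p D x)%E.
  rewrite /normal_prob integral_mkcond; apply: eq_integral => x _.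
  by rewrite /p !patchE; case: ifP.
rewrite /nu integral_mkcond.
have -> : dens \_ (B `*` C) = (fun z : mR * mR => p B z.1 * p C z.2)%E.
  apply/funext => -[x y]; rewrite /p /dens -EFinM !patchE /=.
  rewrite in_setX /=; case: (x \in B); case: (y \in C);
    by rewrite /= ?(mul0r, mulr0).
rewrite fubini_tonelli1; last first.
- by move=> z; rewrite mule_ge0// lee_fin patch_ge0.
- apply: emeasurable_funM.
    by apply: (measurableT_comp (mpatch mB)).
  by apply: (measurableT_comp (mpatch mC)).
rewrite /fubini_F /=.
under eq_integral => x _.
  rewrite ge0_integralZl// ?lee_fin ?patch_ge0//; last 2 first.
  - exact: mpatch.
  - by move=> y _; rewrite lee_fin patch_ge0.
  rewrite -gammaE.
  over.
rewrite /= ge0_integralZr//; last 2 first.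
- exact: mpatch.
- by move=> x _; rewrite lee_fin patch_ge0.
by rewrite -gammaE.
Qed.

(** The joint density depends only on the norm of [z], which the rotation preserves, as it does
    planar Lebesgue measure. *)
Lemma normal_prob_rotation (c s : R) (A : set (mR * mR)) :
  c ^+ 2 + s ^+ 2 = 1 -> s != 0 -> measurable A ->
  (gamma \x gamma)%E
    [set z | A (c * z.1 - s * z.2, s * z.1 + c * z.2)] = (gamma \x gamma)%E A.
Proof.
move=> cs sn0 mA.
have mrot : measurable_fun [set: mR * mR]
    (fun z : mR * mR => (c * z.1 - s * z.2, s * z.1 + c * z.2) : mR * mR).
  apply: measurable_fun_pair => /=.
  - by apply: measurable_funB; apply: measurable_funM.
  - by apply: measurable_funD; apply: measurable_funM.
rewrite !nuE//; last by rewrite -[X in measurable X]setTI; exact: mrot.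
rewrite /nu integral_mkcond [RHS]integral_mkcond.
rewrite -[RHS](ge0_integral_rotation cs sn0); last first.
- by move=> z; rewrite patchE; case: ifP.
- by apply/(measurable_restrictT _ _).1 => //; exact: measurable_funTS.
apply: eq_integral => z _; rewrite !patchE.
have -> : (z \in [set z | A (c * z.1 - s * z.2, s * z.1 + c * z.2)]) =
  ((c * z.1 - s * z.2, s * z.1 + c * z.2) \in A) by apply/idP/idP; rewrite !inE.
case: ifP => // _; rewrite /dens /=; congr EFin.
rewrite !normal_pdfE// /normal_fun !subr0.
rewrite mulrACA [RHS]mulrACA; congr (_ * _).
rewrite -!expRD; congr expR.
(* Inserting the factor c^2 + s^2 = 1 turns the equality of exponents into an identity valid for all
   [c] and [s]. *)
have -> : z.1 ^+ 2 = (c ^+ 2 + s ^+ 2) * z.1 ^+ 2 by rewrite cs mul1r.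
have -> : z.2 ^+ 2 = (c ^+ 2 + s ^+ 2) * z.2 ^+ 2 by rewrite cs mul1r.
field.
by rewrite s0_neq0.
Qed.

End NormalRotation.
End NormalProb.

(** * Level crossings of continuous paths *)

(** The grid is scaled by [t], so that index [2 ^ n] is the time [t] itself on every level. *)
Definition dyadic {R : realType} (t : R) (n k : nat) : R :=
  t * k%:R / (2 ^ n)%:R.

Section Paths.
Context {R : realType}.
Variable f : R -> R.
Hypothesis cf : {within (`[0, +oo[ : set R), continuous f}.

Lemma path_continuousP (a e : R) : 0 <= a -> 0 < e ->
  exists2 d : R, 0 < d & forall s : R, 0 <= s -> `|s - a| < d -> `|f s - f a| < e.
Proof.
move=> a0 e0; have /subspace_continuousP/(_ a) := cf.
rewrite /= in_itv/= a0 => /(_ isT) /cvgrPdist_lt/(_ _ e0).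
rewrite /= near_withinE => /nbhs_ballP[d /= d0 ball_d].
exists d => // s s0 sad; rewrite distrC; apply: ball_d.
  by rewrite /ball/= distrC.
by rewrite /= in_itv/= s0.
Qed.

Lemma path_dyadic (t a e : R) : 0 < t -> 0 <= a <= t -> 0 < e ->
  exists n, exists2 k, (k <= 2 ^ n)%N & `|f (dyadic t n k) - f a| < e.
Proof.
move=> t0 /andP[a0 at_] e0; have [d d0 fd] := path_continuousP a0 e0.
(* This [n] makes the mesh smaller than [d], because t / d < n + 1 <= 2^n. *)
pose n := Num.truncn (t / d).
have tn : t / (2 ^ n)%:R < d.
  rewrite ltr_pdivrMr ?ltr0n ?expn_gt0// mulrC -ltr_pdivrMr//.
  apply: (lt_le_trans (truncnS_gt _)); rewrite ler_nat; exact: ltn_expl.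
have p0 : 0 < (2 ^ n)%:R :> R by rewrite ltr0n expn_gt0.
(* The index of the last grid point not after [a], which is less than one mesh away. *)
pose k := Num.truncn (a * (2 ^ n)%:R / t).
have y0 : 0 <= a * (2 ^ n)%:R / t by rewrite divr_ge0 ?mulr_ge0 // ltW.
have /andP[ky yk] := truncn_itv y0; rewrite -/k in ky yk.
have dE : dyadic t n k = t * k%:R / (2 ^ n)%:R by [].
have dka : dyadic t n k <= a.
  by rewrite dE ler_pdivrMr// mulrC -ler_pdivlMr.
have adk : a < dyadic t n k + t / (2 ^ n)%:R.
  rewrite dE -mulrDl -{2}(mulr1 t) -mulrDr natr1 ltr_pdivlMr//.
  by rewrite [t * _]mulrC -ltr_pdivrMr.
exists n, k.
  rewrite -(ler_nat R) (le_trans ky)// ler_pdivrMr// mulrC.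
  by rewrite ler_pM2l.
apply: fd; first by rewrite dE divr_ge0 ?mulr_ge0// ltW.
by rewrite distrC ger0_norm ?subr_ge0//; lra.
Qed.

(** Near-hits on the grids force the minimum of |f - h| on the compact interval to be 0. Hitting the
    level thus becomes a condition on countably many times, hence an event. *)
Lemma path_attains_dyadic (t h : R) : 0 < t ->
  (exists2 s, 0 <= s <= t & f s = h) <->
  (forall m, exists n, exists2 k, (k <= 2 ^ n)%N &
    `|f (dyadic t n k) - h| <= m.+1%:R^-1).
Proof.
move=> t0; split=> [[s sI <-] m|near_h].
  have [|n [k kn fk]] := path_dyadic t0 sI (e := m.+1%:R^-1).
    by rewrite invr_gt0.
  by exists n, k => //; exact: ltW.
have cg : {within (`[0, +oo[ : set R), continuous (fun s => `|f s - h|)}.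
  apply/subspace_continuousP => s s0; apply: cvg_norm; apply: cvgB.
    by move/subspace_continuousP : cf; exact.
  exact: cvg_cst.
have cn : {within `[0, t], continuous (fun s => `|f s - h|)}.
  by apply: (continuous_subspaceW _ cg); exact: subset_itvl.
have [c cI cmin] := EVT_min (ltW t0) cn.
exists c; first by rewrite in_itv/= in cI.
apply/eqP; rewrite -subr_eq0 -normr_le0; apply/ler_addgt0Pl => e e0.
rewrite addr0.
have [m _ me] := near_infty_natSinv_lt (PosNum e0).
have [n [k kn /le_trans fk]] := near_h m.
apply: le_trans (fk _ (ltW (me m (leqnn m)))).
apply: cmin; rewrite in_itv/= /dyadic divr_ge0 ?mulr_ge0//= ?(ltW t0)//.
by rewrite ler_pdivrMr ?ltr0n ?expn_gt0// ler_pM2l// ler_nat.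
Qed.

Lemma path_attains_level (t h : R) : 0 <= t -> f 0 <= h <= f t ->
  exists2 s, 0 <= s <= t & f s = h.
Proof.
move=> t0 /andP[f0h hft]; have cft : {within `[0, t], continuous f}.
  by apply: (continuous_subspaceW _ cf); exact: subset_itvl.
have [|s sI fs] := IVT (v := h) t0 cft.
  by rewrite ge_min le_max f0h hft orbT.
by exists s => //; rewrite in_itv/= in sI.
Qed.

(** By continuity the level set is closed in the half-line, so its infimum belongs to it. *)
Lemma path_first_hit (h : R) : (exists2 s, 0 <= s & f s = h) ->
  exists s, [/\ 0 <= s, f s = h,
    ereal_inf [set s%:E | s in [set s : R | 0 <= s /\ f s = h]] = s%:E &
    forall u, 0 <= u -> f u = h -> s <= u].
Proof.
move=> [s0 s00 fs0]; set H := [set s : R | _].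
have Hlb : has_lbound H by exists 0 => s [].
have H0 : H !=set0 by exists s0.
have infH0 : 0 <= inf H by apply: lb_le_inf => // s [].
exists (inf H); split=> //; last 2 first.
- exact: ereal_inf_EFin.
- by move=> u u0 fu; apply: ge_inf.
apply/eqP; rewrite -subr_eq0 -normr_le0; apply/ler_addgt0Pl => e e0.
rewrite addr0.
have [d d0 fd] := path_continuousP infH0 e0.
have [s [ss fs] sd] := inf_adherent d0 (conj H0 Hlb).
have iHs : inf H <= s by apply: ge_inf.
rewrite -fs distrC ltW// fd// ger0_norm ?subr_ge0//; lra.
Qed.

End Paths.

Section HittingTime.
Context {T : Type} {R : realType}.
Variables (X : R -> T -> R) (h : R) (w : T).
Hypothesis cX : {within (`[0, +oo[ : set R), continuous (X^~ w)}.

Lemma hitting_time_attained : (exists2 s, 0 <= s & X s w = h) ->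
  exists s, [/\ 0 <= s, X s w = h, hitting_time X h w = s%:E &
    forall u, 0 <= u -> X u w = h -> s <= u].
Proof.
by move=> /(path_first_hit cX)[s [s0 Xs infE smin]]; exists s; split.
Qed.

Lemma hitting_time_le (t : R) :
  (hitting_time X h w <= t%:E)%E <-> (exists2 s, 0 <= s <= t & X s w = h).
Proof.
split=> [|[s /andP[s0 st] Xs]]; last first.
  have [|s1 [_ _ -> s1le]] := hitting_time_attained; first by exists s.
  by rewrite lee_fin (le_trans (s1le s _ _)).
have [hit|nohit] := pselect (exists2 s, 0 <= s & X s w = h).
  have [s [s0 Xs -> _]] := hitting_time_attained hit.
  by rewrite lee_fin => st; exists s; rewrite ?s0.
rewrite /hitting_time (_ : [set s : R | _] = set0) ?image_set0 ?ereal_inf0//.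
by apply/seteqP; split => // s [s0 Xs]; apply: nohit; exists s.
Qed.

Lemma hitting_time_level : (exists2 s, 0 <= s & X s w = h) ->
  X (fine (hitting_time X h w)) w = h.
Proof. by move=> /hitting_time_attained[s [_ Xs -> _]]. Qed.

End HittingTime.

(** * The reflection principle *)

(** The closure rules of measurable sets carry over to [G] because the sigma-algebra generated by
    [G] is [G] itself. *)
Lemma sigma_algebra_setU {T : pointedType} (G : set_system T) A B :
  sigma_algebra setT G -> G A -> G B -> G (A `|` B).
Proof.
move=> sG; rewrite -{1 2 3}(sigma_algebra_id sG).
exact: (@measurableU _ (g_sigma_algebraType G)).
Qed.

Lemma sigma_algebra_setD {T : pointedType} (G : set_system T) A B :
  sigma_algebra setT G -> G A -> G B -> G (A `\` B).
Proof.
move=> sG; rewrite -{1 2 3}(sigma_algebra_id sG).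
exact: (@measurableD _ (g_sigma_algebraType G)).
Qed.

Lemma measurable_le_cst d (T : measurableType d) (R : realType) (f : T -> R) c :
  measurable_fun setT f -> measurable [set w | f w <= c].
Proof.
move=> mf; rewrite (_ : [set w | _] = setT `&` f @^-1` `]-oo, c]); first exact: mf.
by rewrite setTI; apply/seteqP; split => w /=; rewrite in_itv.
Qed.

Lemma measurable_cst_le d (T : measurableType d) (R : realType) (f : T -> R) c :
  measurable_fun setT f -> measurable [set w | c <= f w].
Proof.
move=> mf; rewrite (_ : [set w | _] = setT `&` f @^-1` `[c, +oo[); first exact: mf.
by rewrite setTI; apply/seteqP; split => w /=; rewrite in_itv/= andbT.
Qed.

Section Reflection.
Context d (T : measurableType d) (R : realType) (P : probability T R).
Variables (F : R -> set_system T) (t : R).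
Hypothesis t0 : 0 < t.
Hypothesis F_sigma : forall s : R, 0 <= s -> sigma_algebra setT (F s).
Hypothesis F_sub : forall s : R, 0 <= s -> F s `<=` measurable.
Hypothesis F_mono : forall s u : R, 0 <= s -> s <= u -> F s `<=` F u.

Definition band (X : R -> T -> R) (h e s : R) : set T :=
  [set w | `|X s w - h| <= e].

(** The bound on [j] is strict, so that the band at index [k] minus this event says that the first
    near-hit on the grid occurs at [k]; the whole grid corresponds to k = 2^n + 1. *)
Definition hit_before X h e n k : set T :=
  [set w | exists2 j, (j < k)%N & band X h e (dyadic t n j) w].

(* For a continuous path this says that [X] takes the value [h] on [[0, t]], see
   [hit_path]; in this form it is an event of the sigma-algebra of [X]. *)
Definition hit X h : set T :=
  \bigcap_m \bigcup_n hit_before X h m.+1%:R^-1 n (2 ^ n).+1.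

Lemma hit_beforeS X h e n k :
  hit_before X h e n k.+1 = hit_before X h e n k `|` band X h e (dyadic t n k).
Proof.
apply/seteqP; split=> w /=.
  case=> j; rewrite ltnS leq_eqVlt => /orP[/eqP-> Xj|jk Xj]; first by right.
  by left; exists j.
by move=> [[j jk Xj]|Xk]; [exists j => //; exact: ltnW|exists k].
Qed.

Lemma dyadic_ge0 n k : 0 <= dyadic t n k.
Proof. by rewrite /dyadic divr_ge0 ?mulr_ge0// ltW. Qed.

Lemma dyadic_le n j k : (j <= k)%N -> dyadic t n j <= dyadic t n k.
Proof.
by move=> jk; rewrite /dyadic ler_pM2r ?invr_gt0 ?ltr0n ?expn_gt0// ler_pM2l// ler_nat.
Qed.

Lemma dyadic_top n : dyadic t n (2 ^ n) = t.
Proof. by rewrite /dyadic mulfK// pnatr_eq0 expn_eq0. Qed.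

Lemma dyadicS n k : dyadic t n.+1 (k.*2) = dyadic t n k.
Proof.
by rewrite /dyadic expnS -mul2n !natrM mulrCA -mulf_div divff ?mul1r// pnatr_eq0.
Qed.

Lemma sigma_algebra_hit_before (G : set_system T) X h e n k :
  sigma_algebra setT G ->
  (forall j, (j < k)%N -> G (band X h e (dyadic t n j))) ->
  G (hit_before X h e n k).
Proof.
move=> sG; elim: k => [_|k IH Gband].
  rewrite (_ : hit_before _ _ _ _ _ = set0); last by apply/seteqP; split => // w [].
  by case: sG.
rewrite hit_beforeS; apply: sigma_algebra_setU => //; last exact: Gband.
by apply: IH => j jk; apply: Gband; exact: ltnW.
Qed.

(** The sigma-algebra is left arbitrary: the one generated by the process is used for independence,
    the full one for measurability. *)
Lemma sigma_algebra_hit (G : set_system T) X h :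
  sigma_algebra setT G -> (forall s e : R, 0 <= s -> G (band X h e s)) ->
  G (hit X h).
Proof.
move=> sG Gband.
have Ghb m n : G (hit_before X h m.+1%:R^-1 n (2 ^ n).+1).
  by apply: sigma_algebra_hit_before => // j _; apply: Gband; exact: dyadic_ge0.
rewrite -(sigma_algebra_id sG).
apply: (@bigcapT_measurable _ (g_sigma_algebraType G)) => m.
apply: (@bigcupT_measurable _ (g_sigma_algebraType G)) => n.
by apply: sub_sigma_algebra; exact: Ghb.
Qed.

Section OneSided.
Variable X : R -> T -> R.
Hypothesis X_band : forall s h e : R, 0 <= s -> F s (band X h e s).
Hypothesis mX : forall s : R, 0 <= s -> measurable_fun setT (X s).
Hypothesis X_sym : forall (s : R) A (c : R), 0 <= s <= t -> F s A ->
  P (A `&` [set w | X t w - X s w <= c]) = P (A `&` [set w | - c <= X t w - X s w]).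

Lemma hit_before_adapted h e n k (s : R) :
  (forall j, (j < k)%N -> dyadic t n j <= s) -> 0 <= s -> F s (hit_before X h e n k).
Proof.
move=> ks s0; apply: sigma_algebra_hit_before => [|j jk]; first exact: F_sigma.
apply: F_mono (X_band _ _ (dyadic_ge0 n j)); first exact: dyadic_ge0.
exact: ks.
Qed.

Lemma measurable_hit_before h e n k : measurable (hit_before X h e n k).
Proof.
apply: (F_sub (dyadic_ge0 n k)); apply: hit_before_adapted; last exact: dyadic_ge0.
by move=> j /ltnW; exact: dyadic_le.
Qed.

(** Induction on [k] splits the event by the first near-hit. On each piece, which belongs to the
    past, the remaining increment up to [t] may be replaced by its opposite; passing through the
    band costs [e] twice. *)
Lemma hit_before_reflection (h e : R) n k (b : R) : (k <= (2 ^ n).+1)%N ->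
  (P (hit_before X h e n k `&` [set w | X t w <= b]%R) <=
   P (hit_before X h e n k `&` [set w | 2 * h - b - 2 * e <= X t w]%R))%E.
Proof.
elim: k => [|k IH] kn.
  rewrite (_ : hit_before _ _ _ _ _ = set0) ?set0I//.
  by apply/seteqP; split => // w [].
set E := hit_before X h e n k; set B := band X h e (dyadic t n k).
have s0 := dyadic_ge0 n k.
have st : dyadic t n k <= t by rewrite -[leRHS](dyadic_top n); exact: dyadic_le.
have FBE : F (dyadic t n k) (B `\` E).
  apply: sigma_algebra_setD; [exact: F_sigma|exact: X_band|].
  by apply: hit_before_adapted => // j /ltnW; exact: dyadic_le.
have mE : measurable E by exact: measurable_hit_before.
have mBE := F_sub s0 FBE.
have mXt : measurable_fun setT (X t) by apply: mX; exact: ltW.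
have mincr : measurable_fun setT (X t \- X (dyadic t n k)).
  by apply: measurable_funB => //; exact: mX.
have split_hit A : measurable A ->
    P (hit_before X h e n k.+1 `&` A) = (P (E `&` A) + P ((B `\` E) `&` A))%E.
  move=> mA; rewrite hit_beforeS -/E -/B -measureU.
  - by rewrite -setIUl; congr (P (_ `&` _)); rewrite setDE setUIr setUCr setIT.
  - exact: measurableI.
  - exact: measurableI.
  - by apply/seteqP; split => // w [[Ew _] [[_ /(_ Ew)]]].
rewrite !split_hit//; [|exact: measurable_cst_le|exact: measurable_le_cst].
apply: leeD; first exact/IH/ltnW.
(* On the band X_s >= h - e, so X_t <= b bounds the increment by b - h + e. After the symmetry the
   increment is at least h - b - e, and X_s >= h - e again gives X_t >= 2 h - b - 2 e. *)
apply: (@le_trans _ _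
    (P ((B `\` E) `&` [set w | X t w - X (dyadic t n k) w <= b - h + e]))).
  apply: le_measure; rewrite ?inE.
  - by apply: measurableI => //; exact: measurable_le_cst.
  - by apply: measurableI => //; exact: (measurable_le_cst _ mincr).
  - move=> w [[Bw nEw] /= Xb]; split => //=.
    move: Bw; rewrite /B /band/= ler_norml; lra.
rewrite X_sym ?s0//.
apply: le_measure; rewrite ?inE.
- by apply: measurableI => //; exact: (measurable_cst_le _ mincr).
- by apply: measurableI => //; exact: measurable_cst_le.
- move=> w [[Bw nEw] /= Xb]; split => //=.
  move: Bw; rewrite /B /band/= ler_norml; lra.
Qed.

(** The grids are nested, with index [j] becoming [2 j]; this monotonicity permits continuity from
    below along [n]. *)
Lemma hit_before_homo h e n :
  hit_before X h e n (2 ^ n).+1 `<=` hit_before X h e n.+1 (2 ^ n.+1).+1.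
Proof.
move=> w [j jn Xj]; exists j.*2; last by rewrite /band dyadicS.
by rewrite ltnS expnS mul2n leq_double -ltnS.
Qed.

Lemma measurable_near_hit h e :
  measurable (\bigcup_n hit_before X h e n (2 ^ n).+1).
Proof. by apply: bigcupT_measurable => n; exact: measurable_hit_before. Qed.

Lemma measurable_hit h : measurable (hit X h).
Proof. by apply: bigcapT_measurable => m; exact: measurable_near_hit. Qed.

(** Two limits are taken in the grid inequality: first the grid is refined at fixed tolerance, by
    continuity from below, then the tolerance 1 / (m + 1) tends to 0, by continuity from above. *)
Lemma hit_reflection_le (h b : R) :
  (P (hit X h `&` [set w | X t w <= b]%R) <=
   P (hit X h `&` [set w | 2 * h - b <= X t w]%R))%E.
Proof.
have mXt : measurable_fun setT (X t) by apply: mX; exact: ltW.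
pose near_hit m := \bigcup_n hit_before X h m.+1%:R^-1 n (2 ^ n).+1.
pose U m := [set w | 2 * h - b - 2 * m.+1%:R^-1 <= X t w].
have mL : measurable [set w | X t w <= b] by exact: measurable_le_cst.
have mU m : measurable (U m) by exact: measurable_cst_le.
have mnear m : measurable (near_hit m) by exact: measurable_near_hit.
have step m : (P (hit X h `&` [set w | X t w <= b]%R) <= P (near_hit m `&` U m))%E.
  apply: (@le_trans _ _ (P (near_hit m `&` [set w | X t w <= b]))).
    apply: le_measure; rewrite ?inE; try by apply: measurableI => //; exact: measurable_hit.
    by apply: setSI => w; exact.
  have cvgn : P \o (fun n => hit_before X h m.+1%:R^-1 n (2 ^ n).+1 `&`
      [set w | X t w <= b]) @ \oo --> P (near_hit m `&` [set w | X t w <= b]).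
    rewrite /near_hit setI_bigcupl; apply: nondecreasing_cvg_mu.
    - by move=> n; apply: measurableI => //; exact: measurable_hit_before.
    - by rewrite -setI_bigcupl; apply: measurableI => //; exact: mnear.
    - apply/nondecreasing_seqP => n; apply/subsetPset; apply: setSI.
      exact: hit_before_homo.
  rewrite -(cvg_lim _ cvgn)//; apply: lime_le; first by apply/cvg_ex; eexists; exact: cvgn.
  apply: nearW => n /=; apply: le_trans (hit_before_reflection _ _ _ _) _ => //.
  apply: le_measure; rewrite ?inE; try apply: measurableI => //.
  - exact: measurable_hit_before.
  - exact: mU.
  - by apply: setSI => w; exists n.
(* The slack in [U m] shrinks to 0, so only the closed half-line survives in the intersection. *)
have -> : hit X h `&` [set w | 2 * h - b <= X t w] = \bigcap_m (near_hit m `&` U m).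
  rewrite bigcapI; congr (_ `&` _); apply/seteqP; split => w /=.
    move=> hX m _; rewrite /U/=; apply: le_trans hX; rewrite gerBl.
    by rewrite mulr_ge0 ?invr_ge0.
  move=> Uw; apply/ler_addgt0Pl => e e0.
  have e20 : 0 < e / 2 by rewrite divr_gt0.
  have [m _ /(_ _ (leqnn m)) /= me] := near_infty_natSinv_lt (PosNum e20).
  have {}me : m.+1%:R^-1 < e / 2 := me.
  by have := Uw m I; rewrite /U /=; set y := _^-1 in me *; rewrite -/y; lra.
have cvgn : P \o (fun m => near_hit m `&` U m) @ \oo --> P (\bigcap_m (near_hit m `&` U m)).
  apply: nonincreasing_cvg_mu.
  - by rewrite (le_lt_trans (probability_le1 _ _)) ?ltry//; exact: measurableI.
  - by move=> m; exact: measurableI.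
  - by apply: bigcapT_measurable => m; exact: measurableI.
  - apply/nonincreasing_seqP => m; apply/subsetPset.
    have im : m.+2%:R^-1 <= m.+1%:R^-1 :> R by rewrite lef_pV2 ?posrE// ler_nat.
    apply: setISS => w /=.
      case=> n _ [j jn /le_trans Xj]; exists n => //; exists j => //.
      exact: Xj.
    by rewrite /U /=; apply: le_trans; rewrite lerB// ler_pM2l.
rewrite -(cvg_lim _ cvgn)//; apply: lime_ge; first by apply/cvg_ex; eexists; exact: cvgn.
exact: nearW.
Qed.

End OneSided.

(** One inequality is the one-sided bound with b = 2 h - c; the other is that bound for -X at the
    level -h with b = -c, since -X has the same hitting event and the same symmetry. *)
Lemma reflection_principle (X : R -> T -> R) (h c : R) :
  (forall s h e : R, 0 <= s -> F s (band X h e s)) ->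
  (forall s : R, 0 <= s -> measurable_fun setT (X s)) ->
  (forall (s : R) A (c : R), 0 <= s <= t -> F s A ->
    P (A `&` [set w | X t w - X s w <= c]) =
    P (A `&` [set w | - c <= X t w - X s w])) ->
  P (hit X h `&` [set w | c <= X t w]) =
  P (hit X h `&` [set w | X t w <= 2 * h - c]).
Proof.
move=> Xband mX Xsym; apply/eqP; rewrite eq_le; apply/andP; split; last first.
  have := hit_reflection_le Xband mX Xsym h (2 * h - c).
  by rewrite (_ : 2 * h - (2 * h - c) = c)//; ring.
pose Y s w := - X s w.
have bandN s h' e : band Y h' e s = band X (- h') e s.
  by apply/seteqP; split => w; rewrite /band/Y /= -normrN opprD !opprK.
have hitN : hit Y (- h) = hit X h.
  rewrite /hit /hit_before; apply: eq_bigcapr => m _; apply: eq_bigcupr => n _.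
  by apply/seteqP; split => w [j jn hj]; exists j => //; move: hj; rewrite bandN opprK.
have := @hit_reflection_le Y _ _ _ (- h) (- c); rewrite hitN.
rewrite (_ : [set w | Y t w <= - c] = [set w | c <= X t w]); last first.
  by apply/seteqP; split => w; rewrite /Y /= lerN2.
rewrite (_ : [set w | _ <= Y t w] = [set w | X t w <= 2 * h - c]); last first.
  by apply/seteqP; split => w; rewrite /Y /=; lra.
apply.
- by move=> s h' e s0; rewrite bandN; exact: Xband.
- by move=> s s0; apply: measurableT_comp => //; exact: mX.
- move=> s A c' s0t FA.
  have := Xsym s A c' s0t FA.
  rewrite (_ : [set w | X t w - X s w <= c'] = [set w | - c' <= Y t w - Y s w]);
    last first.
    by apply/seteqP; split => w; rewrite /Y /=; lra.
  rewrite (_ : [set w | - c' <= X t w - X s w] = [set w | Y t w - Y s w <= c']) //.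
  by apply/seteqP; split => w; rewrite /Y /=; lra.
Qed.

End Reflection.

(** * Joint law of the two Brownian motions *)

(** By completeness every subset of the exceptional set is measurable and null, and off that set [A]
    and [B] coincide. Properties of almost every path enter the computation through this lemma. *)
Lemma complete_ae_eq d (T : measurableType d) (R : realType)
    (mu : {measure set T -> \bar R}) (A B : set T) :
  mu.-negligible `<=` measurable -> measurable B ->
  {ae mu, forall w, A w <-> B w} -> mu A = mu B.
Proof.
move=> complete mB AB.
pose N := ~` [set w | A w <-> B w].
have negS C : C `<=` N -> measurable C /\ mu C = 0%E.
  move=> CN; have negC : mu.-negligible C by exact: negligibleS AB.
  have mC := complete _ negC.
  by split => //; exact: (measure_negligible mC negC).
have [mN N0] := negS N (@subset_refl _ _).
have AE : A `\` N = B `\` N.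
  by apply/seteqP; split=> w [ABw nNw]; split => //;
    have /contrapT/= ABE := nNw; apply/ABE.
have muD C : measurable (C `\` N) -> mu C = mu (C `\` N).
  move=> mCD; have [mCN CN0] := negS (C `&` N) (@subIsetr _ _ _).
  rewrite -{1}[C](setUIDK C N) measureU//; first by rewrite [X in (X + _)%E]CN0 add0e.
  by apply/seteqP; split => // w [[_ Nw] [_ /(_ Nw)]].
by rewrite muD ?AE -?muD//; exact: measurableD.
Qed.

Section NormalCdf.
Context {R : realType}.
Variable s : R.
Hypothesis s0 : 0 < s.

Lemma normal_prob_le (y : R) :
  normal_prob 0 s `]-oo, y] = (Phi (y / s))%:E.
Proof.
rewrite normal_prob_scale// /Phi fineK; last exact: fin_num_measure.
congr normal_prob; apply/seteqP; split => z /=;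
  by rewrite !in_itv/= ler_pdivlMr// mulrC.
Qed.

Lemma normal_prob_ge (y : R) :
  normal_prob 0 s `[y, +oo[ = (Phi (- y / s))%:E.
Proof.
rewrite -normal_prob_le -normal_probN ?gt_eqF//; congr normal_prob.
by apply/seteqP; split => z /=; rewrite !in_itv/= andbT lerNr.
Qed.

Lemma normal_prob_gt (y : R) :
  normal_prob 0 s `]y, +oo[ = (Phi (- y / s))%:E.
Proof.
have y0 : normal_prob 0 s [set y] = 0%E.
  have /null_content_dominatesP := @normal_prob_dominates R 0 s; apply.
    exact: measurable_set1.
  exact: lebesgue_measure_set1.
rewrite -normal_prob_ge (_ : `[y, +oo[%classic = [set y] `|` `]y, +oo[%classic).
  rewrite measureU//; first by rewrite [X in (X + _)%E]y0 add0e.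
  by apply/seteqP; split => // z [-> /=]; rewrite in_itv/= ltxx.
by rewrite setU1itv.
Qed.
End NormalCdf.

Section BrownianMotion.
Context d (T : measurableType d) (R : realType) (P : probability T R).
Variables (F : R -> set_system T) (B : R -> T -> R).
Hypothesis hF : usual_filtration P F.
Hypothesis hB : brownian_motion P F B.

Lemma brownian_measurable (s : R) : 0 <= s -> measurable_fun setT (B s).
Proof.
move=> s0 _ U mU; apply: (filtration_sub hF s0).
by apply: (bm_adapted hB s0); exists U.
Qed.

Lemma sigma_rv_band (X : R -> T -> R) (s h e : R) :
  sigma_rv (X s) (band X h e s).
Proof.
exists `[h - e, h + e]%classic; first exact: measurable_itv.
by rewrite setTI; apply/seteqP; split => w; rewrite /band/= in_itv/= ler_distl.
Qed.

Lemma sigma_rv_process (X : R -> T -> R) (s : R) :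
  0 <= s -> sigma_rv (X s) `<=` sigma_process X.
Proof.
move=> s0 A XA; apply: sub_sigma_algebra; exists s => //=.
by rewrite in_itv/= s0.
Qed.

Lemma brownian_increment_sym (s u : R) A (c : R) : 0 <= s <= u -> F s A ->
  P (A `&` [set w | B u w - B s w <= c]) =
  P (A `&` [set w | - c <= B u w - B s w]).
Proof.
move=> /andP[s0]; rewrite le_eqVlt => /orP[/eqP<- _|su FA].
  (* For s = u the increment vanishes and both conditions say 0 <= c. *)
  by congr (P (_ `&` _)); apply/seteqP; split => w /=; rewrite subrr oppr_le0.
have inE1 : [set w | B u w - B s w <= c] = (B u \- B s) @^-1` `]-oo, c].
  by apply/seteqP; split => w /=; rewrite in_itv.
have inE2 : [set w | - c <= B u w - B s w] = (B u \- B s) @^-1` `[- c, +oo[.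
  by apply/seteqP; split => w /=; rewrite in_itv/= andbT.
have indep U : measurable U -> P (A `&` (B u \- B s) @^-1` U) =
    (P A * normal_prob 0 (Num.sqrt (u - s)) U)%E.
  move=> mU; rewrite -(bm_normal_increments hB s0 su mU).
  by apply: (bm_independent_increments hB s0 su FA); exists U; rewrite ?setTI.
have us : 0 < Num.sqrt (u - s) by rewrite sqrtr_gt0 subr_gt0.
rewrite inE1 inE2 !indep//; congr (_ * _)%E.
by rewrite normal_prob_le// normal_prob_ge// opprK.
Qed.

Lemma brownian_reflection_principle (t h c : R) : 0 < t ->
  P (hit t B h `&` [set w | c <= B t w]) =
  P (hit t B h `&` [set w | B t w <= 2 * h - c]).
Proof.
move=> t0; apply: (@reflection_principle _ _ _ _ F t t0).
- exact: (filtration_sigma hF).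
- exact: (filtration_sub hF).
- exact: (filtration_mono hF).
- by move=> s h' e s0; apply: (bm_adapted hB s0); exact: sigma_rv_band.
- exact: brownian_measurable.
- by move=> s A c' /brownian_increment_sym; exact.
Qed.

(** This is the law of the increment from time 0; as B_0 = 0 holds only almost surely, the two
    events are compared up to a null set. *)
Lemma brownian_law (t : R) (U : set R) : 0 < t -> measurable U ->
  P (B t @^-1` U) = normal_prob 0 (Num.sqrt t) U.
Proof.
move=> t0 mU.
have := bm_normal_increments hB (lexx 0) t0 mU; rewrite subr0 => <-.
apply: complete_ae_eq.
- exact/(subset_trans (filtration_complete hF))/(filtration_sub hF).
- rewrite -[X in measurable X]setTI; apply: (measurable_funB _ _ _ mU) => //.
  + by apply: brownian_measurable; exact: ltW.
  + exact: brownian_measurable.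
- by apply: filterS (bm_start hB) => w B0 /=; rewrite B0 subr0.
Qed.

End BrownianMotion.

Section JointLaw.
Context d (T : measurableType d) (R : realType) (P : probability T R).
Variables (F : R -> set_system T) (X Z : R -> T -> R) (t h : R).
Hypothesis hF : usual_filtration P F.
Hypothesis hX : brownian_motion P F X.
Hypothesis hZ : brownian_motion P F Z.
Hypothesis hXZ : independent_processes P X Z.
Hypothesis t0 : 0 < t.
Local Notation mR := (measurableTypeR R).
Local Notation gamma := (@normal_prob R 0 (Num.sqrt t)).
Local Notation D := (hit t X h).

Let mX : measurable_fun setT (X t : T -> mR).
Proof. by apply: (brownian_measurable hF hX); exact: ltW. Qed.

Let mZ : measurable_fun setT (Z t : T -> mR).
Proof. by apply: (brownian_measurable hF hZ); exact: ltW. Qed.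

Let mX_ (U : set mR) : measurable U -> measurable (X t @^-1` U).
Proof. by move=> mU; rewrite -[X in measurable X]setTI; exact: mX. Qed.

Let sigma_process_rv (Y : R -> T -> R) (U : set mR) :
  measurable U -> sigma_process Y (Y t @^-1` U).
Proof.
move=> mU; apply: (sigma_rv_process (ltW t0)).
by exists U; rewrite ?setTI.
Qed.

Let sigma_process_setI A B :
  sigma_process X A -> sigma_process X B -> sigma_process X (A `&` B).
Proof. exact: (@measurableI _ (g_sigma_algebraType _)). Qed.

(** Makes [D], together with the value of [X] at [t], independent of [Z]. *)
Lemma sigma_process_hit : sigma_process X D.
Proof.
apply: sigma_algebra_hit => // [|s e s0]; first exact: smallest_sigma_algebra.
by apply: (sigma_rv_process s0); exact: sigma_rv_band.
Qed.

Lemma measurable_brownian_hit : measurable D.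
Proof.
apply: sigma_algebra_hit => // [|s e s0]; first exact: sigma_algebra_measurable.
apply: (filtration_sub hF s0); apply: (bm_adapted hX s0).
exact: sigma_rv_band.
Qed.
Local Notation mD := measurable_brownian_hit.

Lemma independent_brownian_law A (C : set mR) : sigma_process X A -> measurable C ->
  P (A `&` Z t @^-1` C) = (P A * gamma C)%E.
Proof.
move=> XA mC; rewrite -(brownian_law hF hZ t0 mC).
by apply: hXZ => //; exact: sigma_process_rv.
Qed.

Let mXZ : measurable_fun setT (fun w => (X t w, Z t w) : mR * mR).
Proof. exact: measurable_fun_pair. Qed.

Lemma joint_law (E : set (mR * mR)) : measurable E ->
  P [set w | E (X t w, Z t w)] = (gamma \x gamma)%E E.
Proof.
move=> mE; rewrite (product_measure_unique (m' := pushforward_measure P mXZ))// => U V mU mV.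
rewrite /= /pushforward (_ : _ @^-1` _ = X t @^-1` U `&` Z t @^-1` V)//.
rewrite independent_brownian_law ?(brownian_law hF hX)//.
exact: sigma_process_rv.
Qed.

Let mXr : measurable_fun setT (fun w => 2 * h - X t w : mR).
Proof. by apply: measurable_funB. Qed.

Let mXrZ : measurable_fun setT (fun w => (2 * h - X t w, Z t w) : mR * mR).
Proof. exact: measurable_fun_pair. Qed.

(** The finite measure A -> P (A and [D]); the reflection identities below are equalities between
    its pushforwards. *)
Let PD := measure_function_mrestr__canonical__measure_function_Measure P mD.

(** The reflection principle is the case of closed rays, which are stable under intersection and
    generate the Borel sets; uniqueness of finite measures extends it to every [U]. *)
Lemma hit_law_reflection (U : set mR) : measurable U ->
  P (D `&` X t @^-1` U) = P (D `&` [set w | U (2 * h - X t w)]).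
Proof.
move=> mU; rewrite ![D `&` _]setIC.
apply: (@measure_unique _ R mR (@RGenCInfty.G R) (fun k : nat => `[- k%:R, +oo[%classic)
  (@RGenCInfty.measurableE R) _ _ _
  (pushforward_measure PD mX) (pushforward_measure PD mXr) _ _ U mU).
- move=> _ _ [x ->] [y ->]; exists (Num.max x y).
  by apply/seteqP; split => z; rewrite /= !in_itv/= !andbT ge_max => /andP.
- by move=> k; eexists.
- apply/seteqP; split => // x _; exists (Num.truncn `|x|).+1 => //.
  rewrite /= in_itv/= andbT lerNl ltW// (le_lt_trans (ler_norm _))// normrN.
  exact: truncnS_gt.
- move=> _ [x ->]; rewrite /= /pushforward /= /mrestr ![_ `&` D]setIC.
  have := brownian_reflection_principle hF hX h x t0.
  rewrite (_ : [set w | x <= X t w] = X t @^-1` `[x, +oo[); last first.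
    by apply/seteqP; split => w /=; rewrite in_itv/= andbT.
  move=> ->; congr (P (_ `&` _)).
  by apply/seteqP; split => w /=; rewrite in_itv/= andbT; lra.
- move=> k; apply: (@le_lt_trans _ _ 1%E); last exact: ltry.
  apply: probability_le1; apply: measurableI; last exact: mD.
  by apply: (mX_ (U := `[- k%:R, +oo[)); exact: measurable_itv.
Qed.

(** On rectangles, independence factors out the event on [Z] and leaves the one-dimensional
    reflection; rectangles determine the measure. *)
Lemma joint_reflection (E : set (mR * mR)) : measurable E ->
  P (D `&` [set w | E (X t w, Z t w)]) = P (D `&` [set w | E (2 * h - X t w, Z t w)]).
Proof.
move=> mE.
pose G : set_system (mR * mR) :=
  [set A `*` B | A in measurable & B in measurable].
rewrite ![D `&` _]setIC.
apply: (@measure_unique _ R (mR * mR)%type G (fun=> setT)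
  _ _ _ _ (pushforward_measure PD mXZ) (pushforward_measure PD mXrZ) _ _ E mE).
- by rewrite measurable_prod_measurableType.
- move=> _ _ [A mA [B mB <-]] [A' mA' [B' mB' <-]].
  exists (A `&` A'); first exact: measurableI.
  by exists (B `&` B'); [exact: measurableI|rewrite setXI].
- by move=> k; exists setT => //; exists setT => //; rewrite setXTT.
- by rewrite bigcup_const//; exists 0%N.
- move=> _ [A mA [B mB <-]]; rewrite /= /pushforward /= /mrestr ![_ `&` D]setIC.
  rewrite (_ : _ @^-1` _ = X t @^-1` A `&` Z t @^-1` B)//.
  rewrite [in RHS](_ : _ @^-1` _ = [set w | A (2 * h - X t w)] `&` Z t @^-1` B)//.
  rewrite !setIA !independent_brownian_law//.
  + by rewrite hit_law_reflection.
  + apply: sigma_process_setI; first exact: sigma_process_hit.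
    apply: (@sigma_process_rv _ ((fun y => 2 * h - y) @^-1` A)).
    rewrite -[X in measurable X]setTI.
    by apply: (measurable_funB _ _ _ mA) => //; exact: measurable_id.
  + apply: sigma_process_setI; first exact: sigma_process_hit.
    exact: sigma_process_rv.
- move=> k; apply: (@le_lt_trans _ _ 1%E); last exact: ltry.
  by apply: probability_le1; rewrite preimage_setT setTI; exact: mD.
Qed.

End JointLaw.

(** * Gaussian quadrants and half-planes *)

Section Quadrants.
Context {R : realType}.
Variables s rho : R.
Hypotheses (s0 : 0 < s) (rho0 : 0 < rho) (rho1 : rho < 1).
Local Notation mR := (measurableTypeR R).
Local Notation gamma := (@normal_prob R 0 s).
Local Notation a := (Num.sqrt (2 * (1 + rho))).
Local Notation b := (Num.sqrt (2 * (1 - rho))).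
Local Notation c := (Num.sqrt (1 - rho ^+ 2)).

Let pos1 : 0 < 2 * (1 + rho). Proof. by move: rho0 rho1 => ? ?; lra. Qed.
Let pos2 : 0 < 2 * (1 - rho). Proof. by move: rho0 rho1 => ? ?; lra. Qed.
Let a0 : 0 < a. Proof. by rewrite sqrtr_gt0. Qed.
Let b0 : 0 < b. Proof. by rewrite sqrtr_gt0. Qed.
Let aa : a * a = 2 * (1 + rho). Proof. by rewrite -expr2 sqr_sqrtr// ltW. Qed.
Let bb : b * b = 2 * (1 - rho). Proof. by rewrite -expr2 sqr_sqrtr// ltW. Qed.

(** This is what gives the second variable the same coefficient [c] in both rotated coordinates
    after rescaling. *)
Let ab : a * b = 2 * c.
Proof.
rewrite -sqrtrM; last exact: ltW.
rewrite (_ : 2 * (1 + rho) * (2 * (1 - rho)) = 2 ^+ 2 * (1 - rho ^+ 2)); last by ring.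
by rewrite sqrtrM ?sqr_ge0// sqrtr_sqr gtr0_norm.
Qed.

(* [a / 2] and [b / 2] are the cosine and the sine of the rotation. *)
Let ab1 : (a / 2) ^+ 2 + (b / 2) ^+ 2 = 1.
Proof.
rewrite !expr2 !mulf_div aa bb; lra.
Qed.

Let b2_neq0 : b / 2 != 0. Proof. by rewrite gt_eqF// divr_gt0. Qed.

Lemma scaled_rotation_fst (x y : R) : (a / 2 * x + b / 2 * y) * a = (1 + rho) * x + c * y.
Proof.
have -> : (a / 2 * x + b / 2 * y) * a = a * a / 2 * x + a * b / 2 * y by ring.
by rewrite aa ab; field.
Qed.

Lemma scaled_rotation_snd (x y : R) : (b / 2 * x + a / 2 * y) * b = (1 - rho) * x + c * y.
Proof.
have -> : (b / 2 * x + a / 2 * y) * b = b * b / 2 * x + a * b / 2 * y by ring.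
by rewrite bb ab; field.
Qed.

Lemma scaled_rotation_fstN (x y : R) : (a / 2 * x - b / 2 * y) * a = (1 + rho) * x - c * y.
Proof. by have := scaled_rotation_fst x (- y); rewrite (mulrN (b / 2)) (mulrN c). Qed.

Lemma scaled_rotation_sndN (x y : R) : (b / 2 * x - a / 2 * y) * b = (1 - rho) * x - c * y.
Proof. by have := scaled_rotation_snd x (- y); rewrite (mulrN (a / 2)) (mulrN c). Qed.

(** The rotation with cosine [a / 2] and sine [b / 2] has coordinates U / a and V / b, so the
    quadrant in (U, V) is the preimage of a product of two rays. *)
Lemma normal_quadrant_le (p q : R) :
  (gamma \x gamma)%E [set z : mR * mR |
      p <= (1 + rho) * z.1 - c * z.2 /\ (1 - rho) * z.1 + c * z.2 <= q] =
  (Phi (- p / (a * s)) * Phi (q / (b * s)))%:E.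
Proof.
transitivity ((gamma \x gamma)%E (`[p / a, +oo[ `*` `]-oo, q / b])).
  rewrite -[RHS](@normal_prob_rotation _ _ _ (a / 2) (b / 2)); first last.
  - by apply: measurableX; exact: measurable_itv.
  - exact: b2_neq0.
  - exact: ab1.
  - by rewrite gt_eqF.
  congr ((_ \x _)%E _); apply/seteqP; split => z /=;
    by rewrite !in_itv/= andbT ler_pdivrMr// ler_pdivlMr//
      scaled_rotation_fstN scaled_rotation_snd.
rewrite product_measure1E; [|exact: measurable_itv|exact: measurable_itv].
rewrite /= normal_prob_ge// normal_prob_le// -EFinM.
by rewrite -mulNr -!mulrA -!invfM.
Qed.

(** Here the rotation has the opposite angle, and its second coordinate is -V / b, which reverses
    the inequality on V. The strict bound gives the same value because the normal law has no
    atoms. *)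
Lemma normal_quadrant_ge (p q : R) :
  (gamma \x gamma)%E [set z : mR * mR |
      p < (1 + rho) * z.1 + c * z.2 /\ q <= (1 - rho) * z.1 - c * z.2] =
  (Phi (- q / (b * s)) * Phi (- p / (a * s)))%:E.
Proof.
transitivity ((gamma \x gamma)%E (`]p / a, +oo[ `*` `]-oo, - q / b])).
  rewrite -[RHS](@normal_prob_rotation _ _ _ (a / 2) (- (b / 2))); first last.
  - by apply: measurableX; exact: measurable_itv.
  - by rewrite oppr_eq0.
  - by rewrite sqrrN.
  - by rewrite gt_eqF.
  have rotN (z : mR * mR) :
      ((a / 2 * z.1 - - (b / 2) * z.2) * a = (1 + rho) * z.1 + c * z.2) *
      ((- (b / 2) * z.1 + a / 2 * z.2) * b = - ((1 - rho) * z.1 - c * z.2)).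
    by rewrite -scaled_rotation_fst -scaled_rotation_sndN; split; ring.
  congr ((_ \x _)%E _); apply/seteqP; split => z /=;
    by rewrite !in_itv/= andbT ltr_pdivrMr// ler_pdivlMr// !rotN lerN2.
rewrite product_measure1E; [|exact: measurable_itv|exact: measurable_itv].
rewrite /= normal_prob_gt// normal_prob_le// -EFinM mulrC.
by rewrite -mulNr -!mulrA -!invfM.
Qed.
End Quadrants.

(** * Pathwise reduction to half-planes *)

Lemma hit_path d (T : measurableType d) (R : realType) (X : R -> T -> R)
    (t h : R) w : 0 < t ->
  {within (`[0, +oo[ : set R), continuous (X^~ w)} ->
  hit t X h w <-> (exists2 s, 0 <= s <= t & X s w = h).
Proof.
move=> t0 cX; apply: iff_trans (iff_sym (path_attains_dyadic cX h t0)).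
split=> [hw m|hw m _]; first by have [n _ [k kn Xk]] := hw m I; exists n, k.
by have [n [k kn Xk]] := hw m; exists n => //; exists k.
Qed.

(** The path equals [h] at its hitting time, so the reflection is -X + 2 (X - h). *)
Lemma reflection_after d (T : measurableType d) (R : realType) (X : R -> T -> R)
    (t h : R) w : 0 < t ->
  {within (`[0, +oo[ : set R), continuous (X^~ w)} -> hit t X h w ->
  reflection X h t w = X t w - 2 * h.
Proof.
move=> t0 cX /(hit_path _ t0 cX) hit_w.
have tau_t := (hitting_time_le h cX t).2 hit_w.
rewrite /reflection indicE mem_set// mulr1 hitting_time_level//; first ring.
by case: hit_w => s /andP[s0 _] Xs; exists s.
Qed.

Lemma reflection_before d (T : measurableType d) (R : realType) (X : R -> T -> R)
    (t h : R) w : 0 < t ->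
  {within (`[0, +oo[ : set R), continuous (X^~ w)} -> ~ hit t X h w ->
  reflection X h t w = - X t w.
Proof.
move=> t0 cX nhit; rewrite /reflection indicE memNset ?mulr0 ?addr0//.
by move=> /(hitting_time_le h cX t)/(hit_path _ t0 cX).
Qed.

Section HalfPlanes.
Context {R : realType}.
Local Notation mR := (measurableTypeR R).
Variable h : R.

Lemma measurable_affine_ge (p q r : R) :
  measurable [set z : mR * mR | r <= p * z.1 + q * z.2].
Proof.
apply: (@measurable_cst_le _ (mR * mR)%type) => //.
by apply: measurable_funD; apply: measurable_funM.
Qed.

Lemma measurable_fst_ge : measurable [set z : mR * mR | h <= z.1].
Proof. exact: (@measurable_cst_le _ (mR * mR)%type). Qed.

Lemma measurable_fst_le : measurable [set z : mR * mR | z.1 <= h].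
Proof. exact: (@measurable_le_cst _ (mR * mR)%type). Qed.

Lemma measurable_fst_lt : measurable [set z : mR * mR | z.1 < h].
Proof.
rewrite (_ : [set z | _] = ~` [set z : mR * mR | h <= z.1]).
  by apply: measurableC; exact: measurable_fst_ge.
by apply/seteqP; split => z /=; rewrite ltNge => /negP.
Qed.

Lemma measurable_fst_gt : measurable [set z : mR * mR | h < z.1].
Proof.
rewrite (_ : [set z | _] = ~` [set z : mR * mR | z.1 <= h]).
  by apply: measurableC; exact: measurable_fst_le.
by apply/seteqP; split => z /=; rewrite ltNge => /negP.
Qed.

Definition mirror (z : mR * mR) : mR * mR := (2 * h - z.1, z.2).

Lemma measurable_mirror (E : set (mR * mR)) :
  measurable E -> measurable (mirror @^-1` E).
Proof.
move=> mE; rewrite -[X in measurable X]setTI.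
have mm : measurable_fun [set: mR * mR] mirror.
  apply: measurable_fun_pair => //=.
  by apply: measurable_funB.
exact: mm.
Qed.

Section Quadrants.
Variables (m : {measure set (mR * mR) -> \bar R}) (rho c x : R).

(** The condition B1_t - B2_t >= x on the point (X_t, Z_t) when the reflected path is -X; in
    [after_hit_event] the reflected path is X - 2 h. *)
Definition before_hit_event : set (mR * mR) :=
  [set z | x <= (1 + rho) * z.1 - c * z.2].

Definition after_hit_event : set (mR * mR) :=
  [set z | x - 2 * rho * h <= (1 - rho) * z.1 - c * z.2].

Lemma measurable_before_hit_event : measurable before_hit_event.
Proof.
have := measurable_affine_ge (1 + rho) (- c) x; congr measurable.
by apply/seteqP; split => z; rewrite /before_hit_event /= mulNr.
Qed.

Lemma measurable_after_hit_event : measurable after_hit_event.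
Proof.
have := measurable_affine_ge (1 - rho) (- c) (x - 2 * rho * h); congr measurable.
by apply/seteqP; split => z; rewrite /after_hit_event /= mulNr.
Qed.

Lemma before_hit_mirror z : before_hit_event (mirror z) =
  ((1 + rho) * z.1 + c * z.2 <= 2 * h * (1 + rho) - x).
Proof.
rewrite /before_hit_event /mirror /=; apply/propext; split; lra.
Qed.

Lemma after_hit_mirror z : after_hit_event (mirror z) =
  ((1 - rho) * z.1 + c * z.2 <= 2 * h - x).
Proof.
rewrite /after_hit_event /mirror /=; apply/propext; split; lra.
Qed.

(** With U = (1 + rho) z.1 - c z.2 and V = (1 - rho) z.1 + c z.2 one has U + V = 2 z.1, and the
    corner (x, 2 h - x) lies on z.1 = h. On each side of this line one of the two inequalities
    implies the other. *)
Lemma quadrant_le_split :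
  (m (before_hit_event `&` [set z | z.1 < h]%R) +
   m ((mirror @^-1` after_hit_event) `&` [set z | h <= z.1]%R) =
  m [set z : mR * mR | (x <= (1 + rho) * z.1 - c * z.2)%R /\
    ((1 - rho) * z.1 + c * z.2 <= 2 * h - x)%R])%E.
Proof.
rewrite -measureU.
- congr (m _); apply/seteqP; split => z /=.
    by rewrite after_hit_mirror /before_hit_event /= => -[[]|[]]; lra.
  rewrite after_hit_mirror /before_hit_event /= => -[z1 z2].
  by have [zh|hz] := ltP z.1 h; [left|right].
- by apply: measurableI; [exact: measurable_before_hit_event|exact: measurable_fst_lt].
- apply: measurableI; last exact: measurable_fst_ge.
  by apply: measurable_mirror; exact: measurable_after_hit_event.
- by apply/seteqP; split => // z [[_ /= zh] [_ /=]]; rewrite leNgt zh.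
Qed.

(** With the signs of [c] exchanged, the corner (2 h (1 + rho) - x, x - 2 rho h) again has
    coordinate sum 2 h. The quadrant therefore lies in z.1 > h, and the rest of the half-plane there
    is exactly the mirrored event. *)
Lemma quadrant_ge_split :
  m (after_hit_event `&` [set z | h < z.1]) =
  (m ((mirror @^-1` before_hit_event) `&` [set z | h < z.1]%R) +
  m [set z : mR * mR | (2 * h * (1 + rho) - x < (1 + rho) * z.1 + c * z.2)%R /\
    (x - 2 * rho * h <= (1 - rho) * z.1 - c * z.2)%R])%E.
Proof.
have mmirror := measurable_mirror measurable_before_hit_event.
rewrite -measureU.
- congr (m _); apply/seteqP; split => z /=.
    rewrite before_hit_mirror /after_hit_event /= => -[z1 z2].
    case: (leP ((1 + rho) * z.1 + c * z.2) (2 * h * (1 + rho) - x)) => U.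
      by left.
    by right.
  by rewrite before_hit_mirror /after_hit_event /= => -[[]|[]]; lra.
- by apply: measurableI => //; exact: measurable_fst_gt.
- rewrite (_ : [set z | _] = ~` (mirror @^-1` before_hit_event) `&` after_hit_event).
    by apply: measurableI; [exact: measurableC|exact: measurable_after_hit_event].
  by apply/seteqP; split => z /= [z1 z2]; split => //; move: z1;
    rewrite before_hit_mirror ltNge => /negP.
- apply/seteqP; split => // z [[/= + _] [/=]].
  by rewrite before_hit_mirror ltNge => ->.
Qed.

End Quadrants.
End HalfPlanes.

(** * Elimination of the hitting event *)

Section Decomposition.
Context d (T : measurableType d) (R : realType) (P : probability T R).
Variables (F : R -> set_system T) (t h : R) (X Z : R -> T -> R).
Hypothesis hF : usual_filtration P F.
Hypotheses (t0 : 0 < t) (h0 : 0 < h).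
Hypothesis hX : brownian_motion P F X.
Hypothesis hZ : brownian_motion P F Z.
Hypothesis hXZ : independent_processes P X Z.
Local Notation mR := (measurableTypeR R).
Local Notation D := (hit t X h).
Local Notation gamma2 :=
  (@normal_prob R 0 (Num.sqrt t) \x @normal_prob R 0 (Num.sqrt t))%E.
Local Notation ev E := [set w | (E : set (mR * mR)) (X t w, Z t w)].

(** Almost every path is continuous and starts at 0, below [h], so the intermediate value theorem
    applies. *)
Lemma ae_hit_above : {ae P, forall w, h <= X t w -> D w}.
Proof.
apply: filterS2 (bm_start hX) (bm_continuous hX) => w X0 cX hXt.
apply/(hit_path _ t0 cX); apply: path_attains_level => //; first exact: ltW.
by rewrite X0 ltW.
Qed.

Lemma negligible_measurable : P.-negligible `<=` measurable.
Proof.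
exact/(subset_trans (filtration_complete hF))/(filtration_sub hF).
Qed.

Lemma measurable_joint_event (E : set (mR * mR)) : measurable E -> measurable (ev E).
Proof.
have mXZ : measurable_fun setT (fun w => (X t w, Z t w) : mR * mR).
  apply: measurable_fun_pair.
    exact: (brownian_measurable hF hX (ltW t0)).
  exact: (brownian_measurable hF hZ (ltW t0)).
by move=> mE; rewrite -[X in measurable X]setTI; exact: mXZ.
Qed.

(** Reflection carries [E] to its mirror image [E'] above the level, where [D] holds almost surely
    and drops out. *)
Lemma hit_below (E E' : set (mR * mR)) : measurable E -> measurable E' ->
  (forall z, E' z <-> E (mirror h z)) -> E `<=` [set z | z.1 <= h] ->
  P (D `&` ev E) = gamma2 E'.
Proof.
move=> mE mE' EE' Eh; rewrite (joint_reflection h hF hX hZ hXZ t0 mE).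
rewrite -(joint_law hF hX hZ hXZ t0 mE').
apply: complete_ae_eq.
- exact: negligible_measurable.
- exact: measurable_joint_event.
- apply: filterS ae_hit_above => w hDw; split => [[_ Ew]|/(EE' (_, _)).1 Ew].
    exact: (EE' (_, _)).2.
  split => //; apply: hDw; move/Eh : Ew => /=; lra.
Qed.

(** Below the level, the part off [D] is computed as the whole minus the part on [D], which reflects
    to the second term on the left. That term is added to P S to avoid subtraction in the extended
    reals. *)
Lemma hit_decomposition (S : set T) (G1 G2 : set (mR * mR)) :
  measurable G1 -> measurable G2 ->
  {ae P, forall w, S w <-> D w /\ G2 (X t w, Z t w) \/ ~ D w /\ G1 (X t w, Z t w)} ->
  (P S + gamma2 ((mirror h @^-1` G1) `&` [set z | h < z.1]%R) =
   gamma2 (G1 `&` [set z | z.1 < h]%R) +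
   gamma2 ((mirror h @^-1` G2) `&` [set z | h <= z.1]%R) +
   gamma2 (G2 `&` [set z | h < z.1]%R))%E.
Proof.
move=> mG1 mG2 SE.
set T1 := G1 `&` _; set T2 := _ `&` [set z | h < z.1].
set T3 := G2 `&` _; set T5 := _ `&` [set z | h <= z.1].
pose T4 := G2 `&` [set z | z.1 <= h].
have mT1 : measurable T1 by apply: measurableI => //; exact: measurable_fst_lt.
have mT2 : measurable T2.
  by apply: measurableI; [exact: measurable_mirror|exact: measurable_fst_gt].
have mT3 : measurable T3 by apply: measurableI => //; exact: measurable_fst_gt.
have mT4 : measurable T4 by apply: measurableI => //; exact: measurable_fst_le.
have mT5 : measurable T5.
  by apply: measurableI; [exact: measurable_mirror|exact: measurable_fst_ge].
have mD : measurable D := measurable_brownian_hit h hF hX t0.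
have mT1D : measurable (ev T1 `\` D).
  by apply: measurableD => //; exact: measurable_joint_event.
have mDT4 : measurable (D `&` ev T4).
  by apply: measurableI => //; exact: measurable_joint_event.
have mT3' := measurable_joint_event mT3.
(* The pieces are: below [h] off [D], below or at [h] on [D], and above [h], where [D] is automatic.
   Off [D] the value is almost surely less than [h]. *)
have -> : P S = P ((ev T1 `\` D) `|` (D `&` ev T4) `|` ev T3).
  apply: complete_ae_eq.
  - exact: negligible_measurable.
  - by apply: measurableU => //; exact: measurableU.
  - apply: filterS2 ae_hit_above SE => w hD ->.
    have [Dw|nDw] := pselect (D w).
      split => [[[_ G2w]|[]//]|].
        have [Xh|hX'] := leP (X t w) h; last by right.
        by left; right.
      by move=> [[[_ /(_ Dw)]|[_ [+ _]]]|[+ _]] => //; left.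
    have Xh : X t w < h by rewrite ltNge; apply/negP => /hD.
    split => [[[]//|[_ G1w]]|]; first by left; left.
    move=> [[[[G1w _] _]|[]//]|[_ /= hX']]; first by right.
    by move: Xh; rewrite ltNge ltW.
have -> : P ((ev T1 `\` D) `|` (D `&` ev T4) `|` ev T3) =
    (P (ev T1 `\` D) + P (D `&` ev T4) + P (ev T3))%E.
  rewrite measureU; [rewrite measureU; [reflexivity|..]|..] => //.
  - by apply/seteqP; split => // w [[_ nD] [/nD]].
  - exact: measurableU.
  - apply/seteqP; split => // w [[[[_ /= zh] _]|[_ [_ /= zh]]] [_ /=]].
      by rewrite ltNge ltW.
    by rewrite ltNge zh.
rewrite -(joint_law hF hX hZ hXZ t0 mT1) -(joint_law hF hX hZ hXZ t0 mT3).
have -> : P (D `&` ev T4) = gamma2 T5.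
  apply: hit_below => //; last by move=> z [].
  by move=> z; rewrite /T4 /T5 /=; split => -[? ?]; split => //; lra.
have <- : P (D `&` ev T1) = gamma2 T2.
  apply: hit_below => //; last by move=> z [_ /ltW].
  by move=> z; rewrite /T1 /T2 /=; split => -[? ?]; split => //; lra.
have -> : P (ev T1) = (P (ev T1 `\` D) + P (D `&` ev T1))%E.
  have mT1' := measurable_joint_event mT1.
  rewrite -{1}(setUIDK (ev T1) D) setUC [ev T1 `&` D]setIC.
  rewrite measureU; [reflexivity|..] => //; first exact: measurableI.
  by apply/seteqP; split => // w [[_ nD] [/nD]].
have addeR (u v y z : \bar R) : (u + v + y + z = u + z + v + y)%E.
  by rewrite -!addeA; congr (_ + _)%E; rewrite addeA addeC.
exact: addeR.
Qed.

End Decomposition.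

(** * The probability as a sum of two Gaussian quadrants *)

Theorem proposition2 (R : realType) (d : measure_display)
    (T : measurableType d) (P : probability T R) (F : R -> set_system T)
    (hF : usual_filtration P F) (t h rho x : R) (B1 Z : R -> T -> R)
    (ht : 0 < t) (hh : 0 < h) (hrho0 : 0 < rho) (hrho1 : rho < 1)
    (hB1 : brownian_motion P F B1) (hZ : brownian_motion P F Z)
    (hB1Z : independent_processes P B1 Z) :
  let B2 := fun (s : R) (w : T) =>
    rho * reflection B1 h s w + Num.sqrt (1 - rho ^+ 2) * Z s w in
  P [set w | B1 t w - B2 t w >= x] =
    (Phi ((- x + 2 * rho * h) / Num.sqrt (2 * (1 - rho) * t)) *
     Phi ((x - 2 * h * (1 + rho)) / Num.sqrt (2 * (1 + rho) * t)) +
     Phi ((2 * h - x) / Num.sqrt (2 * (1 - rho) * t)) *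
     Phi (- x / Num.sqrt (2 * (1 + rho) * t)))%:E.
Proof.
move=> B2; set c := Num.sqrt (1 - rho ^+ 2) in B2 *.
set S := [set w | _].
have SE : {ae P, forall w, S w <->
    hit t B1 h w /\ after_hit_event h rho c x (B1 t w, Z t w) \/
    ~ hit t B1 h w /\ before_hit_event rho c x (B1 t w, Z t w)}.
  apply: filterS (bm_continuous hB1) => w cw.
  rewrite /S /B2 /after_hit_event /before_hit_event /=.
  have [hw|nhw] := pselect (hit t B1 h w).
    rewrite reflection_after//; split => [Sw|[[_]|[]//]]; last by lra.
    by left; split => //; lra.
  rewrite reflection_before//; split => [Sw|[[]//|[_]]]; last by lra.
  by right; split => //; lra.
have st : 0 < Num.sqrt t by rewrite sqrtr_gt0.
have pos1 : 0 <= 2 * (1 + rho) by lra.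
have pos2 : 0 <= 2 * (1 - rho) by lra.
(* The mirrored half-plane above [h] occurs on both sides of the decomposition; being finite, it can
   be cancelled. *)
pose mir := (@normal_prob R 0 (Num.sqrt t) \x @normal_prob R 0 (Num.sqrt t))%E
  ((mirror h @^-1` before_hit_event rho c x) `&` [set z | h < z.1]).
have mir_fin : mir \is a fin_num.
  have mE : measurable ((mirror h @^-1` before_hit_event rho c x) `&` [set z | h < z.1]).
    apply: measurableI; last exact: measurable_fst_gt.
    by apply: measurable_mirror; exact: measurable_before_hit_event.
  rewrite /mir -(joint_law hF hB1 hZ hB1Z ht mE); apply: fin_num_measure.
  exact: measurable_joint_event hF ht hB1 hZ _ mE.
have key := hit_decomposition hF ht hh hB1 hZ hB1Z
  (measurable_before_hit_event rho c x) (measurable_after_hit_event h rho c x) SE.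
rewrite -/mir in key.
have {}key : (P S + mir =
   (Phi (- x / (Num.sqrt (2 * (1 + rho)) * Num.sqrt t)) *
    Phi ((2 * h - x) / (Num.sqrt (2 * (1 - rho)) * Num.sqrt t)))%:E +
   (mir +
    (Phi (- (x - 2 * rho * h) / (Num.sqrt (2 * (1 - rho)) * Num.sqrt t)) *
     Phi (- (2 * h * (1 + rho) - x) / (Num.sqrt (2 * (1 + rho)) * Num.sqrt t)))%:E))%E.
  (* The first two terms on the right of the decomposition form one quadrant; the third is [mir]
     plus the other quadrant. *)
  apply: etrans key
    (congr2 adde _ (etrans (quadrant_ge_split _ _ _ _ _) (congr2 adde erefl _))).
    apply: etrans (quadrant_le_split _ _ _ _ _) _.
    exact: normal_quadrant_le.
  exact: normal_quadrant_ge.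
clearbody mir; rewrite -[LHS](@addeK _ mir (P S))// key.
rewrite addeCA [(mir + _)%E]addeC addeK// -EFinD; congr EFin.
rewrite (sqrtrM t pos1) (sqrtrM t pos2).
rewrite [LHS]addrC [X in _ + X = _]mulrC !opprB.
by rewrite [2 * rho * h - x]addrC.
Qed.
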